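(* Fix a MAC grid $\mathcal T=(\mathcal M,\mathcal E)$ and a constant time step $\delta t$. Let $(\rho^{\varepsilon},\boldsymbol u^{\varepsilon},\phi^{\varepsilon})_{\varepsilon>0}$, with $(\rho^{\varepsilon,n},\boldsymbol u^{\varepsilon,n},\phi^{\varepsilon,n})\in L_{\mathcal M}(\Omega)\times\boldsymbol H_{\mathcal E,0}(\Omega)\times L_{\mathcal M}(\Omega)$ and $\rho^{\varepsilon,n}_K>0$, be a sequence of discrete solutions of the scheme (S1)-(S3) given in the context, with respect to initial data $(\rho^\varepsilon_0,\boldsymbol u^\varepsilon_0)\in L^\infty(\Omega)^{1+d}$ satisfying $\rho_0^\varepsilon>0$ and the well-preparedness condition $$\|\boldsymbol u_0^\varepsilon\|_{L^2(\Omega)^d}+\frac1{\varepsilon^2}\|\rho_0^\varepsilon-1\|_{L^\infty(\Omega)}\le C_0$$ with $C_0>0$ independent of $\varepsilon$. Let $(\rho,\boldsymbol u,\phi)$ be a formal limit of this sequence as $\varepsilon\to0$ (i.e. $\rho_K^{\varepsilon,n}\to\rho^n_K$, $u^{\varepsilon,n}_\sigma\to u^n_\sigma$, $\phi^{\varepsilon,n}_K\to\phi^n_K$ for all $K$, $\sigma$, $n$). Then $(\rho,\boldsymbol u,\phi)$ satisfies the following scheme for each $0\le n<N$: $$(\mathrm{div}_{\mathcal M}(\boldsymbol u^n-\boldsymbol Q^{n+1}))_K=0,\quad\forall K\in\mathcal M,$$ $$\frac1{\delta t}(u^{n+1}_\sigma-u^n_\sigma)+\frac1{|D_\sigma|}\sum_{\epsilon\in\tilde{\mathcal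 E}(D_\sigma)}F_{\epsilon,\sigma}(1,\boldsymbol u^n-\boldsymbol Q^{n+1})\,u^n_{\epsilon,\mathrm{up}}+(\partial^{(i)}_{\mathcal E}\phi^{n+1}_* )_\sigma=0,\quad\forall\sigma\in\mathcal E^{(i)}_{\mathrm{int}},\ 1\le i\le d,$$ $$\rho^{n+1}_K=1,\quad\forall K\in\mathcal M,$$ where the correction $\boldsymbol Q^{n+1}\in\boldsymbol H_{\mathcal E,0}(\Omega)$ is given by $Q^{n+1}_\sigma=-\eta\,\delta t\,(\partial^{(i)}_{\mathcal E}\phi^{n+1})_\sigma$ for $\sigma\in\mathcal E^{(i)}_{\mathrm{int}}$, $\phi^{n+1}_*\in L_{\mathcal M}(\Omega)$ is given by $(\phi^{n+1}_* )_K=-\big(\phi^{n+1}_K-(\mathrm{div}_{\mathcal M}\boldsymbol u^n)_K\big)$ for all $K\in\mathcal M$, and $F_{\epsilon,\sigma}(1,\boldsymbol u^n-\boldsymbol Q^{n+1})$ are the dual fluxes built from the primal fluxes $|\sigma|(u^n_{\sigma,K}-Q^{n+1}_{\sigma,K})$.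
   Context: Thermodynamics. $\gamma\ge1$, $p(\rho)=\rho^\gamma$; for $\rho>0$, $\psi_1(\rho)=\rho\ln\rho$ and $\psi_\gamma(\rho)=\rho^\gamma/(\gamma-1)$ if $\gamma>1$. MAC mesh. $\Omega\subset\mathbb R^d$ ($d=2,3$) is open, bounded, connected and its closure is a union of closed axis-parallel rectangles ($d=2$) or parallelepipeds ($d=3$). $\mathcal M$ is a (structured, possibly non-uniform) partition of $\bar\Omega$ into closed axis-parallel rectangles/parallelepipeds $K$; $\mathcal E$ is the set of edges (faces) of the cells; $\mathcal E^{(i)}=\mathcal E^{(i)}_{\mathrm{int}}\cup\mathcal E^{(i)}_{\mathrm{ext}}$ are the internal and external edges orthogonal to the $i$-th canonical basis vector $\boldsymbol e^{(i)}$; $\mathcal E(K)$ is the set of edges of $K$; $\sigma=K|L$ means $\sigma$ is the common edge of $K$ and $L$. $|\cdot|$ denotes $d$- or $(d-1)$-dimensional measure. $D_{\sigma,K}$ is the half of $K$ adjacent to $\sigma\in\mathcal E(K)$; the dual cell is $D_\sigma=D_{\sigma,K}\cup D_{\sigma,L}$ for $\sigma=K|L$ and $D_\sigma=D_{\sigma,K}$ for external $\sigma\in\mathcal E(K)$. $\tilde{\mathcal E}(D_\sigma)$ is the set of edges of $D_\sigma$ ($\epsilon=D_\sigma|D_{\sigma'}$ denotes the edge common to $D_\sigma$ and $D_{\sigma'}$, for $\sigma,\sigma'$ in the same $\mathcal E^{(i)}$). $\boldsymbol\nu_{\sigma,K}$ is the unit normal to $\sigma$ outward to $K$. Boundary conditions.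 $\partial\Omega=\Gamma^D\cup\Gamma^N$ (disjoint, either possibly empty, each external edge being contained in one of the two parts); $\phi=\phi^D$ on $\Gamma^D$, with $\phi^D\in L^\infty(\Omega)\cap H^1(\Omega)$ given, and $\nabla\phi\cdot\boldsymbol\nu=0$ on $\Gamma^N$. Discrete unknowns. $L_{\mathcal M}(\Omega)$: scalar functions constant on each $K$. $\boldsymbol H_{\mathcal E,0}(\Omega)$: vector fields whose $i$-th component is constant on each $D_\sigma$, $\sigma\in\mathcal E^{(i)}$ (value $v_\sigma$), and zero for external $\sigma$. For $\sigma\in\mathcal E^{(i)}\cap\mathcal E(K)$, $v_{\sigma,K}=v_\sigma\,\boldsymbol e^{(i)}\cdot\boldsymbol\nu_{\sigma,K}$. For $q\in L_{\mathcal M}(\Omega)$ and $\sigma=K|L$: $|D_\sigma|q_{D_\sigma}=|D_{\sigma,K}|q_K+|D_{\sigma,L}|q_L$. For $\sigma\in\mathcal E(K)\cap\mathcal E^{(i)}$, $(\partial^{(i)}_{\mathcal E}q)_\sigma=\frac{|\sigma|}{|D_\sigma|}(q_{K_\sigma}-q_K)\,\boldsymbol e^{(i)}\cdot\boldsymbol\nu_{\sigma,K}$, where $q_{K_\sigma}=q_L$ if $\sigma=K|L$, $q_{K_\sigma}=q_K$ if $\sigma\subset\Gamma^N$, and $q_{K_\sigma}=\frac1{|\sigma|}\int_\sigma q^D$ if $\sigma\subset\Gamma^D$, $q^D$ being the boundary value of $q$ ($\phi^D$ for $q=\phi$). $(\mathrm{div}_{\mathcal M}\boldsymbol v)_K=\frac1{|K|}\sum_{\sigma\in\mathcal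 E(K)}|\sigma|v_{\sigma,K}$. $(\Delta_{\mathcal M}q)_K=(\mathrm{div}_{\mathcal M}(\nabla_{\mathcal E}q))_K$ with $\nabla_{\mathcal E}q=(\partial^{(1)}_{\mathcal E}q,\dots,\partial^{(d)}_{\mathcal E}q)$. Interface density: for $\sigma=K|L$, $\rho_\sigma=(\rho_K^\gamma-\rho_L^\gamma)/(\psi_\gamma'(\rho_K)-\psi_\gamma'(\rho_L))$ if $\rho_K\ne\rho_L$, and $\rho_\sigma=\rho_K$ otherwise. Scheme (superscript $\varepsilon$ omitted). $0=t_0<\dots<t_N=T$ with constant step $\delta t>0$; $p^n=p(\rho^n)$; for $0\le n\le N-1$: (S1) $\frac1{\delta t}(\rho_K^{n+1}-\rho_K^n)+\frac1{|K|}\sum_{\sigma\in\mathcal E(K)}F^n_{\sigma,K}=0$ for all $K\in\mathcal M$; (S2) $\frac1{\delta t}(\rho^{n+1}_{D_\sigma}u^{n+1}_\sigma-\rho^n_{D_\sigma}u^n_\sigma)+\frac1{|D_\sigma|}\sum_{\epsilon\in\tilde{\mathcal E}(D_\sigma)}F^n_{\epsilon,\sigma}u^n_{\epsilon,\mathrm{up}}+(\partial^{(i)}_{\mathcal E}p^n)_\sigma=\rho^n_\sigma(\partial^{(i)}_{\mathcal E}(\phi^{n+1}-\Lambda^n))_\sigma$ for all $\sigma\in\mathcal E^{(i)}_{\mathrm{int}}$, $1\le i\le d$; (S3) $\varepsilon^2(\Delta_{\mathcal M}\phi^{n+1})_K=\rho^{n+1}_K-1$ for all $K\in\mathcal M$.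 Initialisation: $\rho^0_K=\frac1{|K|}\int_K\rho_0^\varepsilon$, $u^0_\sigma=\frac1{|D_\sigma|}\int_{D_\sigma}(\boldsymbol u_0^\varepsilon)_i$ for $\sigma\in\mathcal E^{(i)}_{\mathrm{int}}$. Here $F^n_{\sigma,K}=|\sigma|(\rho^n_\sigma u^n_{\sigma,K}-Q^{n+1}_{\sigma,K})$ (zero for external $\sigma$), with stabilisation $\boldsymbol Q^{n+1}\in\boldsymbol H_{\mathcal E,0}(\Omega)$, $Q^{n+1}_\sigma=\eta_\sigma\delta t\,\rho^n_\sigma\big((\partial^{(i)}_{\mathcal E}p^n)_\sigma-\rho^n_\sigma(\partial^{(i)}_{\mathcal E}\phi^{n+1})_\sigma\big)$ for $\sigma\in\mathcal E^{(i)}_{\mathrm{int}}$, $\eta_\sigma=\eta/\rho^n_{D_\sigma}$ with a constant $\eta>5/4$, and $\Lambda^n_K=-\alpha\,\delta t\,\frac{C}{|K|}\sum_{\sigma\in\mathcal E(K)}|\sigma|\rho^n_\sigma u^n_{\sigma,K}$, with constants $\alpha\ge2$ and $C>0$ ($C$ an upper bound of $\psi_\gamma''$). Given primal fluxes $F_{\sigma,K}$, the dual fluxes $F_{\epsilon,\sigma}$ are zero for $\epsilon\subset\partial\Omega$ and otherwise are the standard MAC linear combinations: if $\epsilon=D_\sigma|D_{\sigma'}\subset K$ is parallel to $\sigma,\sigma'\in\mathcal E(K)$, $F_{\epsilon,\sigma}=\frac12(F_{\sigma',K}-F_{\sigma,K})$; if $\epsilon$ is orthogonal to $\sigma=K|L$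 and is contained in $\tau\cup\tau'$ with $\tau\in\mathcal E(K)$, $\tau'\in\mathcal E(L)$, $F_{\epsilon,\sigma}=\frac12(F_{\tau,K}+F_{\tau',L})$. The upwind value for $\epsilon=D_\sigma|D_{\sigma'}$ is $u_{\epsilon,\mathrm{up}}=u_\sigma$ if $F_{\epsilon,\sigma}\ge0$ and $u_{\sigma'}$ otherwise.
   Formalization: The printed correction −(φ^{n+1}_K − (div_M u^n)_K) is false for the given scheme; it is replaced by (φ_*^{n+1})_K = −(φ^{n+1}_K + α δt C (div_M u^n)_K), the limit of −(φ^{n+1} − Λ^n)_K. *)

(* Defs.v *)
From HB Require Import structures.
From mathcomp Require Import all_boot all_order all_algebra.
From mathcomp Require Import all_classical all_reals all_analysis.
Set Implicit Arguments.
Unset Strict Implicit.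
Unset Printing Implicit Defensive.
Import Order.TTheory GRing.Theory Num.Theory numFieldNormedType.Exports.
Local Open Scope classical_set_scope.
Local Open Scope ring_scope.
Section LebesgueMeasure.
Variable R : realType.

Definition cons_pt n (p : measurableTypeR R * n.-tuple (measurableTypeR R)) :
    n.+1.-tuple (measurableTypeR R) :=
  [the n.+1.-tuple _ of p.1 :: p.2].

Lemma measurable_cons_pt n : measurable_fun setT (@cons_pt n).
Proof. exact: measurable_cons. Qed.

Section step.
Variables (n : nat) (mu : {measure set (n.-tuple (measurableTypeR R)) -> \bar R}).

Definition leb_step := pushforward ((@lebesgue_measure R) \x^ mu)%E (@cons_pt n).

Let leb_step0 : leb_step set0 = 0%E.
Proof. by rewrite /leb_step/pushforward preimage_set0 measure0. Qed.

Let leb_step_ge0 A : (0 <= leb_step A)%E.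
Proof. by rewrite /leb_step /pushforward; apply: measure_ge0. Qed.

Let leb_step_sigma_additive : semi_sigma_additive leb_step.
Proof.
move=> F mF tF mUF; rewrite /leb_step /pushforward preimage_bigcup.
have mf : measurable_fun setT (@cons_pt n) by exact: measurable_cons_pt.
apply: measure_semi_sigma_additive.
- by move=> k; rewrite -[X in measurable X]setTI; exact: mf.
- apply/trivIsetP => /= i j _ _ ij; rewrite -preimage_setI.
  by move/trivIsetP : tF => /(_ _ _ _ _ ij) ->//; rewrite preimage_set0.
- by rewrite -preimage_bigcup -[X in measurable X]setTI; exact: mf.
Qed.

HB.instance Definition _ := isMeasure.Build _ _ _
  leb_step leb_step0 leb_step_ge0 leb_step_sigma_additive.
End step.

(* n-dimensional Lebesgue measure on the Borel sets, as an iterated product *)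
Fixpoint leb n : {measure set (n.-tuple (measurableTypeR R)) -> \bar R} :=
  match n with
  | 0%N => dirac ([tuple] : 0.-tuple (measurableTypeR R))
  | n'.+1 => leb_step (leb n')
  end.
End LebesgueMeasure.

(* Integrals and norms of functions on R^d = 'rV[R]_d are computed by
   reading the points of a subset of R^d through a chart c defined on R^n:
   n = d and c = row_of for volumes, n = d.-1 for the faces of a box. *)
Section Charts.
Variables (R : realType) (d n : nat).
Variable c : n.-tuple (measurableTypeR R) -> 'rV[R]_d.
Implicit Types (A : set 'rV[R]_d) (f : 'rV[R]_d -> R).

Definition measurable_on A f := measurable_fun (c @^-1` A) (f \o c).

Definition int_on A f : R := \int[leb R n]_(t in c @^-1` A) (f (c t)).

Definition norm_on (p : \bar R) A f : \bar R :=
  Lnorm (leb R n) p (EFin \o ((f \_ A) \o c)).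

Definition in_Lp p A f := measurable_on A f /\ (norm_on p A f < +oo)%E.

End Charts.

Section FunctionSpaces.
Variables (R : realType) (d : nat).
Local Notation pt := 'rV[R]_d.
Implicit Types (A Omega : set pt) (f g : pt -> R).

Definition row_of (t : d.-tuple (measurableTypeR R)) : pt := \row_i tnth t i.

Definition pos_ae A f :=
  {ae leb R d, forall t, A (row_of t) -> 0 < f (row_of t)}.

(* the norm of L^2(A)^d *)
Definition vec_norm2 A (v : 'I_d -> pt -> R) : \bar R :=
  norm_on row_of 2%:E A (fun x => Num.sqrt (\sum_i (v i x) ^+ 2)).

Definition boundary A : set pt := closure A `\` interior A.

Definition partial (i : 'I_d) f : pt -> R := fun x => 'D_(delta_mx 0 i) f x.

Definition smooth f := forall s : seq 'I_d,
  continuous (foldr partial f s) /\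
  forall i x, derivable (foldr partial f s) x (delta_mx 0 i).

Definition test_function Omega f :=
  smooth f /\ exists C : set pt, [/\ compact C, C `<=` Omega &
    forall x, ~ C x -> f x = 0].

Definition weak_partial Omega (i : 'I_d) f g :=
  forall z, test_function Omega z ->
    int_on row_of Omega (fun x => f x * partial i z x) =
    - int_on row_of Omega (fun x => g x * z x).

(* f is in H^1(Omega), with gradient g *)
Definition in_H1 Omega f (g : 'I_d -> pt -> R) :=
  in_Lp row_of 2%:E Omega f /\
  forall i, in_Lp row_of 2%:E Omega (g i) /\ weak_partial Omega i f (g i).

End FunctionSpaces.

Section MACMesh.
Variables (R : realType) (d : nat).
Local Notation pt := 'rV[R]_d.

(* The cell K is the box \prod_i [lo K i, hi K i]. *)
Record mac_mesh := MACMesh {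
  cell :> finType;
  lo : cell -> 'I_d -> R;
  hi : cell -> 'I_d -> R }.

Variable m : mac_mesh.
Implicit Types (K L : m) (i j : 'I_d) (b c : bool).

(* The face of K orthogonal to e^(i) on its lower (b = false) or upper
   (b = true) side is denoted by the triple (K, i, b). *)
Definition side K i b := if b then hi K i else lo K i.

Definition cell_set K : set pt :=
  [set x | forall i, lo K i <= x 0 i <= hi K i].
Definition cell_int K : set pt :=
  [set x | forall i, lo K i < x 0 i < hi K i].
Definition face K i b : set pt :=
  [set x | x 0 i = side K i b /\
           forall j, j != i -> lo K j <= x 0 j <= hi K j].
Definition face_int K i b : set pt :=
  [set x | x 0 i = side K i b /\
           forall j, j != i -> lo K j < x 0 j < hi K j].

(* nbr K i b = Some L when the face (K, i, b) is the internal edge K|L, which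
   is then also (L, i, ~~ b), and None when it is an external edge *)
Definition nbr K i b : option m :=
  [pick L : m | `[< face L i (~~ b) = face K i b >]].

Definition is_mac_mesh (Omega : set pt) :=
  [/\ forall K i, lo K i < hi K i,
      closure Omega = \bigcup_(K in [set: m]) cell_set K /\
        (forall K, cell_int K `<=` Omega),
      forall K L, K != L -> cell_int K `&` cell_int L = set0,
      (* cells which meet along a part of a face share the whole face *)
      forall K L i, face_int K i true `&` face_int L i false !=set0 ->
        face K i true = face L i false &
      forall K i b, nbr K i b <> None ->
        ~ (face K i b `<=` boundary Omega)].

Definition vol K : R := \prod_i (hi K i - lo K i).
Definition area K i : R := \prod_(j | j != i) (hi K j - lo K j).

(* D_{sigma,K} and D_sigma, for sigma = (K, i, b) *)
Definition half_cell K i b : set pt :=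
  [set x | cell_set K x /\
     let mid := (lo K i + hi K i) / 2 in
     if b then mid <= x 0 i else x 0 i <= mid].
Definition dual_cell K i b : set pt :=
  if nbr K i b is Some L then half_cell K i b `|` half_cell L i (~~ b)
  else half_cell K i b.
Definition half_vol K : R := vol K / 2.
Definition dual_vol K i b : R :=
  if nbr K i b is Some L then half_vol K + half_vol L else half_vol K.

(* e^(i) . nu_{sigma,K} *)
Definition nu b : R := if b then 1 else -1.

(* A field of values v_sigma is a function of (K, i, b) which takes the same
   value on the two triples denoting an internal edge. *)
Definition cell_field := m -> R.
Definition face_field := m -> 'I_d -> bool -> R.

Definition in_HE0 (v : face_field) :=
  (forall K i b L, nbr K i b = Some L -> v K i b = v L i (~~ b)) /\
  (forall K i b, nbr K i b = None -> v K i b = 0).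

(* integrals over cells only see Omega, where the data are defined *)
Definition cell_mean (Omega : set pt) (f : pt -> R) K : R :=
  (vol K)^-1 * int_on (@row_of R d) (cell_set K `&` Omega) f.
Definition dual_mean (Omega : set pt) (f : pt -> R) K i b : R :=
  (dual_vol K i b)^-1 * int_on (@row_of R d) (dual_cell K i b `&` Omega) f.

(* the hyperplane containing (K, i, b) *)
Definition face_chart K i b (t : d.-1.-tuple (measurableTypeR R)) : pt :=
  \row_j (if unlift i j is Some k then tnth t k else side K i b).

Definition face_mean (f : pt -> R) K i b : R :=
  (area K i)^-1 * int_on (face_chart K i b) (face K i b) f.

(* g is, on the face (K, i, b), the trace of f, whose gradient is df *)
Definition trace_on (f : pt -> R) (df : 'I_d -> pt -> R) (g : pt -> R) K i b :=
  in_Lp (face_chart K i b) 2%:E (face K i b) g /\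
  exists w : nat -> pt -> R, [/\
    forall k, smooth (w k),
    norm_on (@row_of R d) 2%:E (cell_int K) (w k \- f) @[k --> \oo] --> 0%E,
    forall j, norm_on (@row_of R d) 2%:E (cell_int K)
      (partial j (w k) \- df j) @[k --> \oo] --> 0%E &
    norm_on (face_chart K i b) 2%:E (face K i b) (w k \- g)
      @[k --> \oo] --> 0%E].

(* An edge belongs to a part of the boundary up to its relative boundary:
   closed edges of the two disjoint parts may touch. *)
Definition boundary_parts (Omega GammaD GammaN : set pt) :=
  [/\ boundary Omega = GammaD `|` GammaN, GammaD `&` GammaN = set0 &
      forall K i b, nbr K i b = None ->
        face_int K i b `<=` GammaD \/ face_int K i b `<=` GammaN].

(* phiD is in L^oo and H^1, and phib is its boundary value on GammaD *)
Definition dirichlet_datum (Omega GammaD : set pt) (phiD phib : pt -> R) :=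
  in_Lp (@row_of R d) +oo%E Omega phiD /\
  exists2 dphi, in_H1 Omega phiD dphi &
    forall K i b, nbr K i b = None -> face_int K i b `<=` GammaD ->
      trace_on phiD dphi phib K i b.

(* The argument qext of dgrad gives q_{K_sigma} for
   external sigma. *)
Definition dgrad (qext : face_field) (q : cell_field) : face_field :=
  fun K i b => area K i / dual_vol K i b *
    ((if nbr K i b is Some L then q L else qext K i b) - q K) * nu b.

Definition phi_ext (GammaD : set pt) (phib : pt -> R) (q : cell_field) :
    face_field :=
  fun K i b =>
    if `[< face_int K i b `<=` GammaD >] then face_mean phib K i b else q K.

(* for fields whose gradient is only used at internal edges *)
Definition dgrad_int (q : cell_field) : face_field :=
  dgrad (fun K _ _ => q K) q.

Definition ddiv (v : face_field) : cell_field :=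
  fun K => (vol K)^-1 * \sum_i \sum_(b : bool) area K i * (v K i b * nu b).

Definition dlap (qext : face_field) (q : cell_field) : cell_field :=
  ddiv (dgrad qext q).

Definition dual_density (q : cell_field) : face_field :=
  fun K i b => (dual_vol K i b)^-1 *
    (half_vol K * q K + if nbr K i b is Some L then half_vol L * q L else 0).

(* F_{sigma,K} = |sigma| v_{sigma,K} *)
Definition flux (v : face_field) : face_field :=
  fun K i b =>
    if nbr K i b is Some _ then area K i * (v K i b * nu b) else 0.

(* Below, sigma = K|L is orthogonal to e^(i) with K on its lower side, and
   (j, c) runs over the faces epsilon of the box D_sigma. *)
Definition dual_flux (F : face_field) K L i j c : R :=
  if j == i then
    let P := if c then L else K in (F P i c - F P i (~~ c)) / 2
  else (F K j c + F L j c) / 2.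

(* The value u_{sigma'}, epsilon = D_sigma|D_sigma'; None if epsilon lies on
   the boundary. When both cells have a neighbour across epsilon, these
   neighbours share the edge sigma'. *)
Definition dual_nbr (u : face_field) K L i j c : option R :=
  if j == i then let P := if c then L else K in Some (u P i c)
  else if nbr K j c is Some K' then Some (u K' i true)
  else if nbr L j c is Some L' then Some (u L' i false)
  else None.

(* \sum_epsilon F_{epsilon,sigma} u_{epsilon,up} *)
Definition upwind_sum (F u : face_field) K L i : R :=
  \sum_j \sum_(c : bool)
    if dual_nbr u K L i j c is Some u' then
      let Fe := dual_flux F K L i j c in
      Fe * (if 0 <= Fe then u K i true else u')
    else 0.

End MACMesh.

Section Scheme.
Variables (R : realType) (d : nat).
Local Notation pt := 'rV[R]_d.

Definition psi (g r : R) : R :=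
  if g == 1 then r * ln r else r `^ g / (g - 1).
Definition dpsi (g : R) : R -> R := derive1 (psi g).
Definition ddpsi (g : R) : R -> R := derive1n 2 (psi g).

Variable m : mac_mesh R d.
Implicit Types (rho phi : cell_field m) (u v : face_field m).

Definition pressure (g : R) rho : cell_field m := fun K => rho K `^ g.

(* on external edges this value is always multiplied by a zero velocity *)
Definition face_density (g : R) rho : face_field m :=
  fun K i b => if nbr K i b is Some L then
    if rho K == rho L then rho K
    else (rho K `^ g - rho L `^ g) / (dpsi g (rho K) - dpsi g (rho L))
  else rho K.

Definition momentum (g : R) rho u : face_field m :=
  fun K i b => face_density g rho K i b * u K i b.

Definition stab (g eta dt : R) rho phi' : face_field m :=
  fun K i b => if nbr K i b is Some _ then
    eta / dual_density rho K i b * dt * face_density g rho K i b *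
      (dgrad_int (pressure g rho) K i b -
       face_density g rho K i b * dgrad_int phi' K i b)
  else 0.

Definition Lambda (alpha dt C : R) v : cell_field m :=
  fun K => - (alpha * dt * C * ddiv v K).

Definition mass_flux (g eta dt : R) rho u phi' : face_field m :=
  flux (fun K i b => momentum g rho u K i b - stab g eta dt rho phi' K i b).

(* primed fields are at time n+1 *)
Definition mass_eq (g eta dt : R) rho rho' u phi' :=
  forall K, (rho' K - rho K) / dt +
    (vol K)^-1 *
      \sum_i \sum_(b : bool) mass_flux g eta dt rho u phi' K i b = 0.

Definition momentum_eq (g eta alpha C dt : R) rho rho' u u' phi' :=
  forall K L i, nbr K i true = Some L ->
    (dual_density rho' K i true * u' K i true -
     dual_density rho K i true * u K i true) / dt +
    (dual_vol K i true)^-1 *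
      upwind_sum (mass_flux g eta dt rho u phi') u K L i +
    dgrad_int (pressure g rho) K i true =
    face_density g rho K i true *
      dgrad_int
        (fun P => phi' P - Lambda alpha dt C (momentum g rho u) P) K i true.

Definition poisson_eq (GammaD : set pt) (phib : pt -> R) (eps : R) rho' phi' :=
  forall K, eps ^+ 2 * dlap (phi_ext GammaD phib phi') phi' K = rho' K - 1.

(* time step n of the scheme, for n < N, from the averaged initial data *)
Definition discrete_solution (Omega GammaD : set pt) (phib : pt -> R)
    (g eta alpha C dt : R) (N : nat) (eps : R)
    (rho0 : pt -> R) (u0 : 'I_d -> pt -> R)
    (rho : nat -> cell_field m) (u : nat -> face_field m)
    (phi : nat -> cell_field m) :=
  [/\ forall n, (n <= N)%N -> in_HE0 (u n) /\ forall K, 0 < rho n K,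
      forall K, rho 0%N K = cell_mean Omega rho0 K,
      forall K i b, nbr K i b <> None ->
        u 0%N K i b = dual_mean Omega (u0 i) K i b &
      forall n, (n < N)%N -> [/\
        mass_eq g eta dt (rho n) (rho n.+1) (u n) (phi n.+1),
        momentum_eq g eta alpha C dt
          (rho n) (rho n.+1) (u n) (u n.+1) (phi n.+1) &
        poisson_eq GammaD phib eps (rho n.+1) (phi n.+1)]].

(* the correction Q^{n+1} of the limit scheme *)
Definition stab_lim (eta dt : R) phi' : face_field m :=
  fun K i b => if nbr K i b is Some _ then - eta * dt * dgrad_int phi' K i b
               else 0.

Definition limit_velocity (eta dt : R) u phi' : face_field m :=
  fun K i b => u K i b - stab_lim eta dt phi' K i b.

End Scheme.

(* Main.v *)
Require Import Defs.
From mathcomp Require Import all_boot all_order all_algebra.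
From mathcomp Require Import all_classical all_reals all_analysis.
From mathcomp Require Import ess_sup_inf measurable_realfun lra.
Import Order.TTheory GRing.Theory Num.Theory numFieldNormedType.Exports.
Local Open Scope classical_set_scope.
Local Open Scope ring_scope.

(** On a fixed mesh every term of the scheme is an expression in finitely many
   reals, so passing to the limit amounts to the continuity of each term, once
   every density is known to tend to 1.

   For n >= 1 this is the Poisson equation: rho - 1 is eps^2 times the discrete
   Laplacian of phi, which converges and hence stays bounded ([poisson_cvg1]).
   For n = 0 the density is the cell average of the initial datum, and
   well-preparedness gives |rho0 - 1| <= C0 eps^2 almost everywhere in Omega.
   The average is taken over the part of the cell in Omega and divided by the
   volume of the whole cell; both have the same measure because the open cell
   lies in Omega ([leb_cell], [cell_mean_dist]).

   Two terms are not visibly continuous. The interface density is a difference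
   quotient of the pressure with respect to psi', hence 0 / 0 in the limit; but
   p' = rho psi'', so by the mean value theorem it lies between the two
   adjacent densities and tends to 1 ([face_density_mean],
   [face_density_cvg1]). The upwind product jumps in its second factor only
   where the flux vanishes, so that it is jointly continuous ([upwind_cvg]).

   With densities and interface densities tending to 1, the pressure gradient
   tends to 0, the stabilisation tends to Q = - eta dt grad phi
   ([stab_cvg]), and the potential phi - Lambda tends to the opposite of the
   limit potential phi_*, which turns the force into a pressure gradient
   ([limit_mass_eq], [limit_momentum_eq]). *)

Set Implicit Arguments.
Unset Strict Implicit.
Unset Printing Implicit Defensive.

(** * The interface density as a mean value *)

Section InterfaceDensity.
Variable R : realType.
Implicit Types a b c g r x : R.

(** The closed form of psi' on positive densities, see [dpsiE]. *)
Definition enthalpy g x : R :=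
  if g == 1 then ln x + 1 else g / (g - 1) * x `^ (g - 1).

Lemma dpsiE g x : 0 < x -> dpsi g x = enthalpy g x.
Proof.
move=> x0; rewrite /dpsi /enthalpy derive1E; case: eqVneq => [->|g1].
- have -> : psi 1 = (fun r : R => r * ln r) by apply/funext => r; rewrite /psi eqxx.
  have := is_derive1_ln x0 => dl.
  by rewrite derive_val /GRing.scale /= mulfV ?gt_eqF// mulr1 addrC.
- have -> : psi g = (fun r : R => (g - 1)^-1 *: (r `^ g)).
    by apply/funext => r; rewrite /psi (negbTE g1) mulrC.
  have dp := is_derive1_powR g x0.
  by rewrite derive_val /GRing.scale /= mulrA (mulrC _ g).
Qed.

Lemma is_derive_enthalpy g x : 0 < x ->
  is_derive x 1 (enthalpy g) (g * x `^ (g - 1) / x).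
Proof.
move=> x0; rewrite /enthalpy; case: eqVneq => [->|g1].
- rewrite subrr powRr0 !mul1r.
  have dl := is_derive1_ln x0.
  by apply: is_derive_eq; rewrite addr0.
- have dp := is_derive1_powR (g - 1) x0.
  apply: is_derive_eq.
  rewrite /GRing.scale /= mulrA divfK ?subr_eq0//.
  by rewrite -mulrA (_ : x `^ (g - 1 - 1) = x `^ (g - 1) / x)//
     powRB ?(gt_eqF x0) ?implybT// powRr1 ?ltW.
Qed.

(** Since p' (x) = x psi'' (x), the function p - c psi' has derivative
   psi'' (x) (x - c), whose sign changes only at c. *)
Lemma is_derive_pressure_enthalpy g c x : 0 < x ->
  is_derive x 1 (fun y => y `^ g - c * enthalpy g y)
    (g * x `^ (g - 1) / x * (x - c)).
Proof.
move=> x0; have dp := is_derive1_powR g x0.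
have de := is_derive_enthalpy g x0.
apply: is_derive_eq; rewrite /GRing.scale /= mulrBr divfK ?gt_eqF//.
by rewrite (mulrC c).
Qed.

Lemma is_derive_MVT (f df : R -> R) a b : 0 < a -> a < b ->
  (forall x, 0 < x -> is_derive x 1 f (df x)) ->
  exists2 c, a < c < b & f b - f a = df c * (b - a).
Proof.
move=> a0 ab dfx.
have [||c cab ->] := @MVT R f df a b ab.
- by move=> x; rewrite in_itv/= => /andP[ax _]; apply: dfx; apply: lt_trans ax.
- apply: derivable_within_continuous => x; rewrite in_itv/= => /andP[ax _].
  by have [] := dfx x (lt_le_trans a0 ax).
- by exists c => //; move: cab; rewrite in_itv.
Qed.

(** The function p - a psi' increases to the right of a, and p - b psi'
   decreases to the left of b; these are the two bounds. *)
Lemma enthalpy_mean g a b : 1 <= g -> 0 < a -> a < b ->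
  a <= (b `^ g - a `^ g) / (enthalpy g b - enthalpy g a) <= b.
Proof.
move=> g1 a0 ab.
have p0 x : a < x < b -> 0 < g * x `^ (g - 1) / x.
  move=> /andP[ax _]; have x0 := lt_trans a0 ax.
  by rewrite divr_gt0// mulr_gt0 ?powR_gt0// (lt_le_trans ltr01).
have ba : 0 < b - a by rewrite subr_gt0.
have [x xab E] := is_derive_MVT a0 ab (is_derive_enthalpy g).
have e0 : 0 < enthalpy g b - enthalpy g a by rewrite E mulr_gt0 ?p0.
rewrite ler_pdivlMr// ler_pdivrMr//; apply/andP; split.
- have [y yab F] := is_derive_MVT a0 ab (@is_derive_pressure_enthalpy g a).
  rewrite -subr_ge0.
  have -> : b `^ g - a `^ g - a * (enthalpy g b - enthalpy g a) =
    b `^ g - a * enthalpy g b - (a `^ g - a * enthalpy g a) by lra.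
  rewrite F; case/andP: (yab) => ay yb.
  by rewrite mulr_ge0 ?(ltW ba)// mulr_ge0 ?(ltW (p0 _ yab))// subr_ge0 ltW.
- have [y yab F] := is_derive_MVT a0 ab (@is_derive_pressure_enthalpy g b).
  rewrite -subr_le0.
  have -> : b `^ g - a `^ g - b * (enthalpy g b - enthalpy g a) =
    b `^ g - b * enthalpy g b - (a `^ g - b * enthalpy g a) by lra.
  rewrite F; case/andP: (yab) => ay yb.
  by rewrite mulr_le0_ge0 ?(ltW ba)// mulr_ge0_le0 ?(ltW (p0 _ yab))// subr_le0 ltW.
Qed.

(** Replaces the singular quotient by bounds which pass to the limit. *)
Lemma face_density_mean d (m : mac_mesh R d) g (rho : cell_field m) K i t L :
  1 <= g -> (forall K, 0 < rho K) -> nbr K i t = Some L ->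
  Num.min (rho K) (rho L) <= face_density g rho K i t <= Num.max (rho K) (rho L).
Proof.
move=> g1 rho0 KL; rewrite /face_density KL; case: eqVneq => [->|].
  by rewrite minxx maxxx lexx.
rewrite !dpsiE// => /eqP; case: (ltgtP (rho K) (rho L)) => // lt _.
- by rewrite -mulrNN -invrN !opprB; apply: enthalpy_mean.
- exact: enthalpy_mean.
Qed.
End InterfaceDensity.

(** * Lebesgue measure of boxes, and cell averages *)

Section BoxMeasure.
Variables (R : realType) (d : nat).
Implicit Types (A : 'I_d -> set R).

Definition tbox n (A : 'I_n -> set (measurableTypeR R)) :
    set (n.-tuple (measurableTypeR R)) :=
  [set t | forall i, A i (tnth t i)].

Lemma measurable_tbox n (A : 'I_n -> set (measurableTypeR R)) :
  (forall i, measurable (A i)) -> measurable (tbox A).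
Proof.
move=> mA.
have -> : tbox A = \bigcap_(i : 'I_n) ((@tnth _ _ ^~ i) @^-1` A i).
  by apply/seteqP; split=> t /= tA; [move=> i _|move=> i]; apply: tA.
apply: fin_bigcap_measurable => // i _.
by rewrite -[X in measurable X]setTI; apply: measurable_tnth.
Qed.

Lemma leb_tbox n (A : 'I_n -> set (measurableTypeR R)) :
  (forall i, measurable (A i)) ->
  leb R n (tbox A) = (\prod_(i < n) lebesgue_measure (A i))%E.
Proof.
elim: n A => [|n IHn] A mA.
  rewrite big_ord0 /= diracE mem_set// => -[]//.
rewrite big_ord_recl -IHn// /leb -/(leb _) /= /leb_step /pushforward.
rewrite -product_measure2E//; last exact: measurable_tbox.
congr (_ _); apply/seteqP; split=> -[x t] /=.
  move=> xt; split=> [|i]; first exact: (xt ord0).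
  by have := xt (lift ord0 i); rewrite tnthS.
move=> [/= xA tA] i; have [j ->|->] := unliftP ord0 i; rewrite ?tnthS//.
Qed.

Lemma preimage_row_of_tbox A :
  @row_of R d @^-1` [set x | forall i, A i (x 0 i)] = tbox A.
Proof. by apply/seteqP; split=> t /= tA i; have := tA i; rewrite mxE. Qed.

(** The measurable sets of tuples are generated by the coordinates; an open
   set belongs to them as the union of the boxes with rational corners that it
   contains. *)
Lemma measurable_row_of_open (O : set 'rV[R]_d) :
  open O -> measurable (@row_of R d @^-1` O).
Proof.
move=> oO.
pose box (q : {ffun 'I_d -> rat * rat}) : set 'rV[R]_d :=
  [set x | forall i, `]ratr (q i).1, ratr (q i).2[%classic (x 0 i)].
have -> : O = \bigcup_(q : {ffun 'I_d -> rat * rat})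
    (if `[< box q `<=` O >] then box q else set0).
  apply/seteqP; split=> x; last by move=> [q _]; case: asboolP => // qO /qO.
  rewrite -{1}(interior_id O).1// => /nbhs_ballP[e /= e0 xeO].
  have bnd i : exists q : rat * rat, [/\ x 0 i - e < ratr q.1, ratr q.1 < x 0 i,
      x 0 i < ratr q.2 & ratr q.2 < x 0 i + e].
    have /rat_in_itvoo[p] : x 0 i - e < x 0 i by rewrite ltrBlDr ltrDl.
    have /rat_in_itvoo[q] : x 0 i < x 0 i + e by rewrite ltrDl.
    by rewrite !in_itv/= => /andP[? ?] /andP[? ?]; exists (p, q).
  pose q := [ffun i => projT1 (cid (bnd i))].
  have qP i : [/\ x 0 i - e < ratr (q i).1, ratr (q i).1 < x 0 i,
      x 0 i < ratr (q i).2 & ratr (q i).2 < x 0 i + e].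
    by rewrite ffunE; case: cid.
  exists q => //; case: asboolP => [_ i|].
    by have [? ? ? ?] := qP i; rewrite /= in_itv/=; apply/andP.
  case=> y qy; apply: xeO; split=> // i j; rewrite ord1.
  have [? ? ? ?] := qP j; have := qy j; rewrite /= in_itv/= => /andP[? ?].
  by rewrite /ball/= ltr_distlC; apply/andP; split; lra.
rewrite preimage_bigcup; apply: countable_bigcupT_measurable => // q.
case: asboolP => _; last by rewrite preimage_set0.
rewrite /box
  (preimage_row_of_tbox (fun i => `]ratr (q i).1, ratr (q i).2[%classic)).
by apply: measurable_tbox => i; exact: measurable_itv.
Qed.

(** [s] and [t] tell which ends belong to the sides, so that open and closed
   boxes are treated at once. *)
Lemma leb_tbox_itv n (a b : 'I_n -> R) (s t : bool) :
  (forall i, a i < b i) ->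
  leb R n (tbox (fun i => [set` Interval (BSide s (a i)) (BSide t (b i))])) =
    (\prod_i (b i - a i))%:E.
Proof.
move=> ab; rewrite leb_tbox => [|i]; last exact: measurable_itv.
rewrite -prodEFin; apply: eq_bigr => i _.
by rewrite lebesgue_measure_itv /= lte_fin ab EFinB.
Qed.

End BoxMeasure.

Section CellMean.
Variables (R : realType) (d : nat) (m : mac_mesh R d) (Omega : set 'rV[R]_d).
Hypothesis hm : is_mac_mesh m Omega.

Lemma lo_lt_hi (K : m) i : lo K i < hi K i.
Proof. by case: hm. Qed.

Lemma vol_gt0 (K : m) : 0 < vol K.
Proof. by apply: prodr_gt0 => i _; rewrite subr_gt0 lo_lt_hi. Qed.

Hypothesis Omega_open : open Omega.

Lemma measurable_cell (K : m) :
  measurable (@row_of R d @^-1` (cell_set K `&` Omega)).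
Proof.
rewrite preimage_setI; apply: measurableI; last exact: measurable_row_of_open.
rewrite (_ : cell_set K = [set x | forall i, `[lo K i, hi K i]%classic (x 0 i)]).
  rewrite (preimage_row_of_tbox (fun i => `[lo K i, hi K i]%classic)).
  by apply: measurable_tbox => i; apply: measurable_itv.
by apply/seteqP; split=> x xK i; have := xK i; rewrite /= in_itv.
Qed.

(** Omega contains the open cell but perhaps not all of its boundary; the open
   and the closed box have the same measure. *)
Lemma leb_cell (K : m) :
  leb R d (@row_of R d @^-1` (cell_set K `&` Omega)) = (vol K)%:E.
Proof.
have [_ [_ intO] _ _ _] := hm.
have mbox s t : measurable
    (tbox (fun i => [set` Interval (BSide s (lo K i)) (BSide t (hi K i))])).
  by apply: measurable_tbox => i; apply: measurable_itv.
apply/eqP; rewrite eq_le; apply/andP; split.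
- rewrite -(@leb_tbox_itv _ _ (lo K) (hi K) true false) => [|i]; last exact: lo_lt_hi.
  rewrite le_measure ?inE//; first exact: measurable_cell.
  by move=> t [tK _] i /=; have := tK i; rewrite mxE in_itv.
- rewrite -(@leb_tbox_itv _ _ (lo K) (hi K) false true) => [|i]; last exact: lo_lt_hi.
  rewrite le_measure ?inE//; first exact: measurable_cell.
  move=> t tK; have tI : cell_int K (row_of t).
    by move=> i; rewrite mxE; have := tK i; rewrite /= in_itv.
  by split; [move=> i; have /andP[? ?] := tI i; rewrite !ltW|apply: intO tI].
Qed.

(** The L^oo norm is an essential supremum because the whole space has
   positive measure, as it contains the cell [K]. *)
Lemma norm_oo_ae_le (f : 'rV[R]_d -> R) (c : R) (K : m) :
  (norm_on (@row_of R d) +oo%E Omega f <= c%:E)%E ->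
  {ae leb R d, forall t, (@row_of R d @^-1` (cell_set K `&` Omega)) t ->
    `|f (row_of t)| <= c}.
Proof.
rewrite /norm_on Lnorm.unlock ifT; last first.
  apply: (@lt_le_trans _ _ (vol K)%:E); first by rewrite lte_fin vol_gt0.
  rewrite -leb_cell le_measure ?inE//; first exact: measurable_cell.
move/ess_supP; apply: filterS => t /= + [_ tO].
by rewrite /patch mem_set//= lee_fin.
Qed.

(** As the measure of the domain of integration is the volume of the cell, the
   difference is the average of f - 1. *)
Lemma cell_mean_dist (f : 'rV[R]_d -> R) (c : R) (K : m) :
  measurable_on (@row_of R d) Omega f -> 0 <= c ->
  (norm_on (@row_of R d) +oo%E Omega (fun x => f x - 1)%R <= c%:E)%E ->
  `|cell_mean Omega f K - 1| <= c.
Proof.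
move=> mf c0 /(norm_oo_ae_le K).
set A := (_ @^-1` _) => fc.
have mA : measurable A := measurable_cell K.
have volA : leb R d A = (vol K)%:E := leb_cell K.
have mfA : measurable_fun A (fun t => f (row_of t)).
  by apply: measurable_funS mf; [exact: measurable_row_of_open|move=> t []].
have m1 : measurable_fun A (fun t => f (row_of t) - 1) by exact: measurable_funB.
have le_int : (\int[leb R d]_(t in A) `|(f (row_of t) - 1)%:E| <= (c * vol K)%:E)%E.
  rewrite EFinM -volA; apply: integral_le_bound => //; exact/measurable_EFinP.
have i1 : (leb R d).-integrable A (EFin \o (fun t => f (row_of t) - 1)).
  apply/integrableP; split; first exact/measurable_EFinP.
  exact: le_lt_trans le_int (ltry _).
have ic (r : R) : (leb R d).-integrable A (EFin \o cst r).
  apply/integrableP; split; first exact/measurable_EFinP.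
  by rewrite (integral_cst _ mA `|r|%:E)%E volA -EFinM ltry.
have i1' : (leb R d).-integrable A (EFin \o (fun t => f (row_of t))).
  have := integrableD mA i1 (ic 1); apply: eq_integrable => // t _ /=.
  by rewrite -EFinD subrK.
have -> : cell_mean Omega f K - 1 =
    (vol K)^-1 * \int[leb R d]_(t in A) (f (row_of t) - 1).
  rewrite RintegralB// ?(ic 1)// Rintegral_cst// volA/= mul1r mulrBr mulVf//.
  by rewrite gt_eqF ?vol_gt0.
have v0 := vol_gt0 K.
rewrite normrM gtr0_norm ?invr_gt0// ler_pdivrMl// mulrC.
apply: le_trans (le_normr_Rintegral mA i1) _.
rewrite -lee_fin (le_trans _ le_int)// /Rintegral fineK//.
by apply: integrable_fin_num => //; exact: integrable_norm.
Qed.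

(** Well-preparedness keeps the averages within [c] eps^2 of 1. *)
Lemma initial_density_cvg1 (f : R -> 'rV[R]_d -> R) (c : R) (K : m) : 0 < c ->
  (forall eps, 0 < eps -> measurable_on (@row_of R d) Omega (f eps)) ->
  (forall eps, 0 < eps ->
    (((eps ^+ 2)^-1)%R%:E *
      norm_on (@row_of R d) +oo%E Omega (fun x => f eps x - 1)%R <= c%:E)%E) ->
  cell_mean Omega (f eps) K @[eps --> 0^'+] --> (1 : R).
Proof.
move=> c0 mf fc.
have eps2 : (eps : R) ^+ 2 @[eps --> 0^'+] --> (0 : R).
  rewrite -[X in _ --> X](@expr0n R 2).
  by apply: (@cvg_at_right_filter _ R^o); exact: exprn_continuous.
apply/cvgrPdist_le => r r0; near=> eps.
have e0 : 0 < eps by near: eps; exact: nbhs_right_gt.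
rewrite distrC; apply: (@le_trans _ _ (c * eps ^+ 2)).
  apply: cell_mean_dist; [exact: mf|by rewrite mulr_ge0 ?sqr_ge0 ?ltW|].
  by rewrite EFinM -lee_pdivrMr ?exprn_gt0// muleC; apply: fc.
rewrite mulrC -ler_pdivlMr//; near: eps.
have : 0 < r / c by rewrite divr_gt0.
move/cvgrPdist_le: eps2 => /[apply]; apply: filterS => eps.
by rewrite sub0r normrN ger0_norm ?sqr_ge0.
Unshelve. all: by end_near. Qed.

End CellMean.

(** * Continuity of the discrete operators *)

Section DiscreteLimits.
Variables (R : realType) (d : nat) (m : mac_mesh R d).
Variables (T : Type) (F : set_system T).
Context {FF : ProperFilter F}.
Implicit Types (q : T -> cell_field m) (ql : cell_field m).
Implicit Types (v : T -> face_field m) (vl : face_field m).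

Definition cell_cvg q ql := forall K, q e K @[e --> F] --> ql K.
Definition face_cvg v vl := forall K i b, v e K i b @[e --> F] --> vl K i b.

Lemma cvg_big_sum (I : Type) (r : seq I) (P : pred I) (f : T -> I -> R)
    (l : I -> R) :
  (forall i, P i -> f e i @[e --> F] --> l i) ->
  \sum_(i <- r | P i) f e i @[e --> F] --> \sum_(i <- r | P i) l i.
Proof. by apply: cvg_big; exact: add_continuous. Qed.

Lemma cvg_eq0 (f : T -> R) (l : R) :
  (\forall e \near F, f e = 0) -> f e @[e --> F] --> l -> l = 0.
Proof.
move=> f0 fl; apply: cvg_unique fl _ => //.
apply: cvg_near_cst; exact: f0.
Qed.

Lemma ddiv_cvg v vl : face_cvg v vl -> cell_cvg (fun e => ddiv (v e)) (ddiv vl).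
Proof.
move=> vvl K; apply: cvgMl_tmp; apply: cvg_big_sum => i _; apply: cvg_big_sum => b _.
by apply: cvgMl_tmp; apply: cvgMr_tmp; apply: vvl.
Qed.

Lemma dgrad_cvg v vl q ql : face_cvg v vl -> cell_cvg q ql ->
  face_cvg (fun e => dgrad (v e) (q e)) (dgrad vl ql).
Proof.
move=> vvl qql K i b; apply: cvgMr_tmp; apply: cvgMl_tmp; apply: cvgB; last exact: qql.
by case: nbr => [L|]; [apply: qql|apply: vvl].
Qed.

Lemma dgrad_int_cvg q ql : cell_cvg q ql ->
  face_cvg (fun e => dgrad_int (q e)) (dgrad_int ql).
Proof. by move=> qql; apply: dgrad_cvg => // K i b; apply: qql. Qed.

Lemma dual_density_cvg q ql : cell_cvg q ql ->
  face_cvg (fun e => dual_density (q e)) (dual_density ql).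
Proof.
move=> qql K i b; apply: cvgMl_tmp; apply: cvgD; first by apply: cvgMl_tmp; apply: qql.
by case: nbr => [L|]; [apply: cvgMl_tmp; apply: qql|apply: cvg_cst].
Qed.

Lemma flux_cvg v vl : face_cvg v vl -> face_cvg (fun e => flux (v e)) (flux vl).
Proof.
move=> vvl K i b; rewrite /flux; case: nbr => [L|]; last exact: cvg_cst.
by apply: cvgMl_tmp; apply: cvgMr_tmp; apply: vvl.
Qed.

Lemma dual_flux_cvg v vl K L i j c : face_cvg v vl ->
  dual_flux (v e) K L i j c @[e --> F] --> dual_flux vl K L i j c.
Proof.
move=> vvl; rewrite /dual_flux; case: eqP => _; apply: cvgMr_tmp.
  by apply: cvgB; apply: vvl.
by apply: cvgD; apply: vvl.
Qed.

Lemma upwindE (a x y : R) :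
  a * (if 0 <= a then x else y) = (a + `|a|) / 2 * x + (a - `|a|) / 2 * y.
Proof. by case: ger0P => _; lra. Qed.

(** By [upwindE] the product is the positive part of the flux times [x] plus its
   negative part times [y], and both parts are continuous, also where the flux
   changes sign. *)
Lemma upwind_cvg (a x y : T -> R) (al xl yl : R) :
  a e @[e --> F] --> al -> x e @[e --> F] --> xl -> y e @[e --> F] --> yl ->
  a e * (if 0 <= a e then x e else y e) @[e --> F] -->
    al * (if 0 <= al then xl else yl).
Proof.
move=> aal xxl yyl; under eq_fun do rewrite upwindE.
rewrite upwindE; apply: cvgD; apply: cvgM => //; apply: cvgMr_tmp.
  by apply: cvgD => //; apply: cvg_norm.
by apply: cvgB => //; apply: cvg_norm.
Qed.

Lemma upwind_sum_cvg v vl (u : T -> face_field m) (ul : face_field m) K L i :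
  face_cvg v vl -> face_cvg u ul ->
  upwind_sum (v e) (u e) K L i @[e --> F] --> upwind_sum vl ul K L i.
Proof.
move=> vvl uul; apply: cvg_big_sum => j _; apply: cvg_big_sum => c _.
have up (P : m) b :
    dual_flux (v e) K L i j c *
    (if 0 <= dual_flux (v e) K L i j c then u e K i true else u e P i b)
      @[e --> F] -->
    dual_flux vl K L i j c *
    (if 0 <= dual_flux vl K L i j c then ul K i true else ul P i b).
  by apply: upwind_cvg; [apply: dual_flux_cvg|apply: uul|apply: uul].
rewrite /dual_nbr; case: (j == i); first exact: up.
case: (nbr K j c) => [K'|]; first exact: up.
by case: (nbr L j c) => [L'|]; [exact: up|exact: cvg_cst].
Qed.

Lemma phi_ext_cvg GammaD phib q ql : cell_cvg q ql ->
  face_cvg (fun e => phi_ext GammaD phib (q e)) (phi_ext GammaD phib ql).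
Proof.
move=> qql K i b; rewrite /phi_ext; case: asboolP => _; first exact: cvg_cst.
exact: qql.
Qed.

(** The Dirichlet value of the potential is the same for all [e], so the discrete
   Laplacian converges, and the vanishing factor in front of it leaves 1. *)
Lemma poisson_cvg1 GammaD phib (eps : T -> R) q phi phil :
  eps e @[e --> F] --> (0 : R) -> cell_cvg phi phil ->
  (\forall e \near F, poisson_eq GammaD phib (eps e) (q e) (phi e)) ->
  cell_cvg q (fun=> 1).
Proof.
move=> eps0 phiphil poisson K.
have lap : dlap (phi_ext GammaD phib (phi e)) (phi e) K @[e --> F] -->
    dlap (phi_ext GammaD phib phil) phil K.
  by apply: ddiv_cvg; apply: dgrad_cvg => //; exact: phi_ext_cvg.
have lim : eps e * eps e * dlap (phi_ext GammaD phib (phi e)) (phi e) K + 1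
    @[e --> F] --> (1 : R).
  rewrite -[X in _ --> X]add0r -(mul0r (dlap (phi_ext GammaD phib phil) phil K)).
  rewrite -[X in X * _ + _](mul0r 0).
  by apply: cvgD; [apply: cvgM => //; apply: cvgM|exact: cvg_cst].
apply: cvg_trans lim; apply: near_eq_cvg; apply: filterS poisson => e /(_ K).
by rewrite -expr2 => ->; rewrite subrK.
Qed.

Lemma pressure_cvg1 g q : cell_cvg q (fun=> 1) ->
  cell_cvg (fun e => pressure g (q e)) (fun=> 1).
Proof.
move=> q1 K; have <- : 1 `^ g = 1 :> R by rewrite powR1.
apply: (@continuous_cvg _ _ _ _ _ _ (fun x => x `^ g)) (q1 K).
apply/differentiable_continuous/derivable1_diffP.
by have [] := is_derive1_powR g (@ltr01 R).
Qed.

(** External faces carry the density of their cell; internal ones are squeezed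
   between two densities that tend to 1. *)
Lemma face_density_cvg1 g q : 1 <= g -> (\forall e \near F, forall K, 0 < q e K) ->
  cell_cvg q (fun=> 1) ->
  face_cvg (fun e => face_density g (q e)) (fun _ _ _ => 1).
Proof.
move=> g1 q0 q1 K i b; case E : (nbr K i b) => [L|]; last first.
  by rewrite /face_density E; apply: q1.
apply/cvgrPdist_le => r r0; near=> e.
have eK : `|1 - q e K| <= r by near: e; apply: cvgr_dist_le r0; apply: q1.
have eL : `|1 - q e L| <= r by near: e; apply: cvgr_dist_le r0; apply: q1.
have /(face_density_mean g1)/(_ E)/andP[] : forall K, 0 < q e K by near: e.
rewrite ge_min le_max; move: eK eL; rewrite !ler_norml.
by move=> /andP[? ?] /andP[? ?] /orP[?|?] /orP[?|?]; apply/andP; split; lra.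
Unshelve. all: by end_near. Qed.

(** * The limit scheme *)

Section LimitScheme.
Variable Omega : set 'rV[R]_d.
Hypothesis hm : is_mac_mesh m Omega.

Lemma dual_density1 (K : m) i b : dual_density (fun=> 1) K i b = 1.
Proof.
have v0 (P : m) : 0 < half_vol P by rewrite divr_gt0 ?(vol_gt0 hm).
rewrite /dual_density /dual_vol; case: nbr => [L|].
  by rewrite !mulr1 mulVf// gt_eqF// addr_gt0.
by rewrite mulr1 addr0 mulVf// gt_eqF.
Qed.

Lemma dgrad_int_cst (c : R) (K : m) i b : dgrad_int (fun=> c) K i b = 0.
Proof. by rewrite /dgrad_int /dgrad; case: nbr => [L|]; rewrite subrr mulr0 mul0r. Qed.

Variables (g eta alpha C dt : R).
Hypothesis g1 : 1 <= g.
(* [rho], [u] are taken at time n and [rho'], [u'], [phi] at time n+1 *)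
Variables (rho rho' phi : T -> cell_field m) (u u' : T -> face_field m).
Variables (phil : cell_field m) (ul ul' : face_field m).
Hypothesis rho0 : \forall e \near F, forall K, 0 < rho e K.
Hypothesis rho1 : cell_cvg rho (fun=> 1).
Hypothesis rho1' : cell_cvg rho' (fun=> 1).
Hypothesis u_cvg : face_cvg u ul.
Hypothesis u_cvg' : face_cvg u' ul'.
Hypothesis phi_cvg : cell_cvg phi phil.

Lemma momentum_cvg : face_cvg (fun e => momentum g (rho e) (u e)) ul.
Proof.
move=> K i b; rewrite -[X in _ --> X]mul1r.
by apply: cvgM; [apply: face_density_cvg1|apply: u_cvg].
Qed.

(** The pressure part of the stabilisation disappears, since the pressure tends
   to a constant. *)
Lemma stab_cvg :
  face_cvg (fun e => stab g eta dt (rho e) (phi e)) (stab_lim eta dt phil).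
Proof.
move=> K i b; rewrite /stab /stab_lim; case: nbr => [L|]; last exact: cvg_cst.
have fd := face_density_cvg1 g1 rho0 rho1 (K := K) (i := i) (b := b).
(* each factor of the stabilisation is replaced by its limit *)
have -> : - eta * dt * dgrad_int phil K i b =
    eta / 1 * dt * 1 * (0 - 1 * dgrad_int phil K i b) by lra.
apply: cvgM.
  apply: cvgM => //; apply: cvgMr_tmp; apply: cvgMl_tmp; apply: cvgV => //.
  rewrite -(dual_density1 K i b); exact: dual_density_cvg.
apply: cvgB; last by apply: cvgM => //; apply: dgrad_int_cvg.
by rewrite -(dgrad_int_cst 1 K i b); apply: dgrad_int_cvg; apply: pressure_cvg1.
Qed.

Lemma mass_flux_cvg :
  face_cvg (fun e => mass_flux g eta dt (rho e) (u e) (phi e))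
    (flux (limit_velocity eta dt ul phil)).
Proof.
apply: flux_cvg => K i b; apply: cvgB; [exact: momentum_cvg|exact: stab_cvg].
Qed.

(** The time derivative of the density drops out because both densities tend to
   the same constant; what remains of mass conservation is the divergence. *)
Lemma limit_mass_eq :
  (\forall e \near F, in_HE0 (u e) /\
     mass_eq g eta dt (rho e) (rho' e) (u e) (phi e)) ->
  forall K, ddiv (limit_velocity eta dt ul phil) K = 0.
Proof.
move=> sol K; set w := limit_velocity _ _ _ _.
(* On external faces the flux is zero by definition, and the limit velocity
   because u is. *)
have -> : ddiv w K = (vol K)^-1 * \sum_i \sum_(b : bool) flux w K i b.
  congr (_ * _); apply: eq_bigr => i _; apply: eq_bigr => b _.
  rewrite /flux; case E : (nbr K i b) => [//|].
  rewrite /w /limit_velocity /stab_lim E subr0.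
  have -> : ul K i b = 0; last by rewrite mul0r mulr0.
  apply: (@cvg_eq0 (fun e => u e K i b)); last exact: u_cvg.
  by apply: filterS sol => e [[_ /(_ K i b E)]].
apply: (@cvg_eq0 (fun e => (rho' e K - rho e K) / dt + (vol K)^-1 *
    \sum_i \sum_(b : bool) mass_flux g eta dt (rho e) (u e) (phi e) K i b)).
  by apply: filterS sol => e [_ /(_ K)].
rewrite -[X in _ --> X]add0r; apply: cvgD.
  rewrite -[X in _ --> X](mul0r dt^-1) -(subrr 1).
  by apply: cvgMr_tmp; apply: cvgB; [apply: rho1'|apply: rho1].
apply: cvgMl_tmp; apply: cvg_big_sum => i _; apply: cvg_big_sum => b _.
exact: mass_flux_cvg.
Qed.

(** The pressure gradient has limit 0, so the limit force is all that balances
   the inertia; written on the left it is the gradient of the opposite of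
   phi - Lambda. *)
Lemma limit_momentum_eq :
  (\forall e \near F, momentum_eq g eta alpha C dt
     (rho e) (rho' e) (u e) (u' e) (phi e)) ->
  forall K L i, nbr K i true = Some L ->
    (ul' K i true - ul K i true) / dt +
    (dual_vol K i true)^-1 *
      upwind_sum (flux (limit_velocity eta dt ul phil)) ul K L i +
    dgrad_int (fun P => - (phil P - Lambda alpha dt C ul P)) K i true = 0.
Proof.
move=> sol K L i KL.
pose force e P := phi e P - Lambda alpha dt C (momentum g (rho e) (u e)) P.
pose forcel P := phil P - Lambda alpha dt C ul P.
have force_cvg : cell_cvg force forcel.
  move=> P; apply: cvgB; first exact: phi_cvg.
  by apply: cvgN; apply: cvgMl_tmp; apply: ddiv_cvg; exact: momentum_cvg.
have dens q : cell_cvg q (fun=> 1) ->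
    dual_density (q e) K i true @[e --> F] --> (1 : R).
  by move=> q1; rewrite -(dual_density1 K i true); exact: dual_density_cvg.
have -> : dgrad_int (fun P => - (phil P - Lambda alpha dt C ul P)) K i true =
    - (1 * dgrad_int forcel K i true).
  by rewrite mul1r /dgrad_int /dgrad KL -opprD mulrN mulNr.
apply: (@cvg_eq0 (fun e =>
    (dual_density (rho' e) K i true * u' e K i true -
     dual_density (rho e) K i true * u e K i true) / dt +
    (dual_vol K i true)^-1 *
      upwind_sum (mass_flux g eta dt (rho e) (u e) (phi e)) (u e) K L i +
    dgrad_int (pressure g (rho e)) K i true -
    face_density g (rho e) K i true * dgrad_int (force e) K i true)).
  by apply: filterS sol => e /(_ K L i KL) ->; rewrite subrr.
apply: cvgB; last first.
  by apply: cvgM; [exact: face_density_cvg1|exact: dgrad_int_cvg].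
rewrite -[X in _ --> X]addr0; apply: cvgD; last first.
  rewrite -(dgrad_int_cst 1 K i true); apply: dgrad_int_cvg.
  exact: pressure_cvg1.
apply: cvgD; last first.
  by apply: cvgMl_tmp; apply: upwind_sum_cvg => //; exact: mass_flux_cvg.
apply: cvgMr_tmp; rewrite -[X in X - _]mul1r -[X in _ - X]mul1r.
by apply: cvgB; apply: cvgM; [exact: dens|exact: u_cvg'|exact: dens|exact: u_cvg].
Qed.

End LimitScheme.
End DiscreteLimits.

Unset Implicit Arguments.
Set Strict Implicit.
Set Printing Implicit Defensive.

Theorem proposition6p2 (R : realType) (d : nat) (hd : d = 2%N \/ d = 3%N)
  (* domain, mesh and boundary conditions *)
  (Omega : set 'rV[R]_d)
  (Omega_open : open Omega) (Omega_bounded : bounded_set Omega)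
  (Omega_connected : connected Omega)
  (m : mac_mesh R d) (hm : is_mac_mesh m Omega)
  (GammaD GammaN : set 'rV[R]_d)
  (hGamma : boundary_parts m Omega GammaD GammaN)
  (phiD phib : 'rV[R]_d -> R)
  (hphiD : dirichlet_datum m Omega GammaD phiD phib)
  (* parameters *)
  (g eta alpha C dt C0 : R) (N : nat)
  (hg : 1 <= g) (heta : 5 / 4 < eta) (halpha : 2 <= alpha) (hC : 0 < C)
  (hdt : 0 < dt) (hC0 : 0 < C0)
  (* initial data *)
  (rho0 : R -> 'rV[R]_d -> R) (u0 : R -> 'I_d -> 'rV[R]_d -> R)
  (hrho0 : forall eps : R, 0 < eps ->
     in_Lp (@row_of R d) +oo%E Omega (rho0 eps) /\ pos_ae Omega (rho0 eps))
  (hu0 : forall eps : R, 0 < eps ->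
     forall i, in_Lp (@row_of R d) +oo%E Omega (u0 eps i))
  (well_prepared : forall eps : R, 0 < eps ->
     (vec_norm2 Omega (u0 eps) +
      ((eps ^+ 2)^-1)%R%:E *
        norm_on (@row_of R d) +oo%E Omega (fun x => rho0 eps x - 1)%R
      <= C0%:E)%E)
  (* discrete solutions *)
  (rho : R -> nat -> cell_field m) (u : R -> nat -> face_field m)
  (phi : R -> nat -> cell_field m)
  (hsol : forall eps : R, 0 < eps ->
     discrete_solution Omega GammaD phib g eta alpha C dt N eps
       (rho0 eps) (u0 eps) (rho eps) (u eps) (phi eps))
  (C_bound : forall (eps : R) n K, 0 < eps -> (n <= N)%N ->
     ddpsi g (rho eps n K) <= C)
  (* formal limit *)
  (rhol : nat -> cell_field m) (ul : nat -> face_field m)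
  (phil : nat -> cell_field m)
  (cvg_rho : forall n K, (n <= N)%N ->
     rho eps n K @[eps --> 0^'+] --> rhol n K)
  (cvg_u : forall n K i b, (n <= N)%N ->
     u eps n K i b @[eps --> 0^'+] --> ul n K i b)
  (cvg_phi : forall n K, (0 < n <= N)%N ->
     phi eps n K @[eps --> 0^'+] --> phil n K) :
  forall n, (n < N)%N ->
    let w := limit_velocity eta dt (ul n) (phil n.+1) in
    let phistar : cell_field m :=
      fun K => - (phil n.+1 K - Lambda alpha dt C (ul n) K) in
    [/\ forall K, ddiv w K = 0,
        forall K L i, nbr K i true = Some L ->
          (ul n.+1 K i true - ul n K i true) / dt +
          (dual_vol K i true)^-1 * upwind_sum (flux w) (ul n) K L i +
          dgrad_int phistar K i true = 0 &
        forall K, rhol n.+1 K = 1].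
Proof.
have eps_gt0 : \forall eps \near 0^'+, (0 : R) < eps by exact: nbhs_right_gt.
have rho_gt0 n : (n <= N)%N ->
    \forall eps \near 0^'+, forall K, 0 < rho eps n K.
  move=> nN; apply: filterS eps_gt0 => eps e0 K.
  by have [/(_ n nN)[_]] := hsol _ e0.
have phicvg n : (n < N)%N -> cell_cvg 0^'+ (fun eps => phi eps n.+1) (phil n.+1).
  by move=> nN K; exact: cvg_phi.
have ucvg n : (n <= N)%N -> face_cvg 0^'+ (fun eps => u eps n) (ul n).
  by move=> nN K i b; exact: cvg_u.
have rho1 n : (n <= N)%N -> cell_cvg 0^'+ (fun eps => rho eps n) (fun=> 1).
  case: n => [_ K|n nN].
  - have lim : cell_mean Omega (rho0 eps) K @[eps --> 0^'+] --> (1 : R).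
      apply: (initial_density_cvg1 hm Omega_open K hC0) => eps e0.
        by have [[]] := hrho0 _ e0.
      apply: le_trans (well_prepared _ e0); rewrite leeDr// /vec_norm2.
      exact: Lnorm_ge0.
    apply: cvg_trans lim; apply: near_eq_cvg; apply: filterS eps_gt0 => eps e0.
    by have [_ ->] := hsol _ e0.
  - apply: (@poisson_cvg1 _ _ _ _ _ _ GammaD phib id) (phicvg n nN) _.
      by apply: (@cvg_at_right_filter _ R^o); exact: cvg_id.
    apply: filterS eps_gt0 => eps e0.
    by have [_ _ _ /(_ n nN)[]] := hsol _ e0.
move=> n nN w phistar; have nN' := ltnW nN; split.
- apply: (limit_mass_eq hm hg (rho_gt0 n nN') (rho1 n nN') (rho1 n.+1 nN)
    (ucvg n nN') (phicvg n nN)).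
  apply: filterS eps_gt0 => eps e0; have [/(_ n nN')[uH _] _ _] := hsol _ e0.
  by move=> /(_ n nN)[].
- apply: (limit_momentum_eq hm hg (rho_gt0 n nN') (rho1 n nN') (rho1 n.+1 nN)
    (ucvg n nN') (ucvg n.+1 nN) (phicvg n nN)).
  apply: filterS eps_gt0 => eps e0.
  by have [_ _ _ /(_ n nN)[]] := hsol _ e0.
- by move=> K; apply: cvg_unique (cvg_rho _ K nN) (rho1 _ nN K).
Qed.
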